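(* Let $n\ge 1$, $r\ge 0$, and let $f_1,\ldots,f_r$ be a generic sequence of quadratic forms in $A=k\langle x_1,\ldots,x_n\rangle$. Then the family $\{x_if_j\}\cup\{f_jx_i\}$, $1\le i\le n$, $1\le j\le r$ (consisting of $2nr$ elements of $A_3$), is either linearly independent or spans $A_3$.
   Context: $k$ is a field with prime field $k_0$; it is a standing assumption that $k$ has sufficiently high transcendence degree over $k_0$ (at least the number of indeterminates $c$ below). $k\langle x_1,\ldots,x_n\rangle$ is the free associative algebra, graded with $\deg x_i=1$, and $A_3$ is its degree 3 component. A quadratic form is a homogeneous element of degree 2. For a graded algebra $B=\bigoplus_i B_i$ write $B(z)=\sum_i\dim(B_i)z^i$. Let $c=\{c^i_m\}$, with $1\le i\le r$ and $m$ ranging over the $n^2$ non-commutative monomials of degree 2, be a set of indeterminates, and put $A_t=k_0(c)\langle x_1,\ldots,x_n\rangle/(f_{1,c},\ldots,f_{r,c})$ with $f_{i,c}=\sum_m c^i_m m$. The sequence $(f_1,\ldots,f_r)$ of quadratic forms is called generic if the algebra $k\langle x_1,\ldots,x_n\rangle/(f_1,\ldots,f_r)$ has Hilbert series equal to $A_t(z)$. *)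

(* Defs.v *)
From HB Require Import structures.
From mathcomp Require Import all_boot all_algebra.
From mathcomp Require Import mpoly.
From mathcomp Require Import monalg.

Set Implicit Arguments.
Unset Strict Implicit.
Unset Printing Implicit Defensive.

Import GRing.Theory.
Local Open Scope ring_scope.

(* K<x_1, ..., x_n> is the monoid algebra of the free monoid on 'I_n. *)
Notation freealg K n := {malg K[{fmonom 'I_n}]}.

(* Commutative polynomials, from mpoly. Several of its names and notations
   (mcoeff, msupp, mmap, {mpoly R[n]}) are shadowed by those of monalg. *)
Notation polyring R N := (mpoly.mpoly N R).

Definition fvar (K : fieldType) (n : nat) (i : 'I_n) : freealg K n :=
  << fmu i >>.

Definition homogeneous (K : fieldType) (n d : nat) (g : freealg K n) : Prop :=
  forall m, mcoeff m g != 0 -> fdeg m = d.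

Definition ideal_of (K : fieldType) (n r : nat) (f : 'I_r -> freealg K n)
    (g : freealg K n) : Prop :=
  exists s : seq (freealg K n * 'I_r * freealg K n),
    g = \sum_(t <- s) t.1.1 * f t.1.2 * t.2.

(* With I the two-sided ideal (f_1, ..., f_r) generated by homogeneous f_j,
   the degree d component of the quotient is the image of that of the free
   algebra; [quotient_dim f d m] says that this image has a basis of m
   elements, represented by homogeneous elements b_i of degree d. *)
Definition quotient_dim (K : fieldType) (n r : nat) (f : 'I_r -> freealg K n)
    (d m : nat) : Prop :=
  exists b : 'I_m -> freealg K n,
    [/\ forall i, homogeneous d (b i),
        forall a : 'I_m -> K,
          ideal_of f (\sum_i a i *: b i) -> forall i, a i = 0
      & forall g, homogeneous d g ->
          exists a : 'I_m -> K, ideal_of f (g - \sum_i a i *: b i)].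

(* H d is the coefficient of z^d. *)
Definition hilbert_series (K : fieldType) (n r : nat)
    (f : 'I_r -> freealg K n) (H : nat -> nat) : Prop :=
  forall d, quotient_dim f d (H d).

(* The triple (j, (u, v)) indexes the coefficient of the monomial x_u x_v in
   the j-th form. *)
Notation coef_index n r := ('I_r * ('I_n * 'I_n))%type.

Definition coef_field (k0 : fieldType) (n r : nat) : fieldType :=
  {fraction (polyring k0 #|{: coef_index n r}|)}.

Definition indet (k0 : fieldType) (n r : nat) (t : coef_index n r) :
    coef_field k0 n r :=
  tofrac (mpoly.mpolyX k0 (mpoly.mnm1 (enum_rank t))).

Definition generic_form (k0 : fieldType) (n r : nat) (j : 'I_r) :
    freealg (coef_field k0 n r) n :=
  \sum_(m : 'I_n * 'I_n) indet k0 (j, m) *: (fvar _ m.1 * fvar _ m.2).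

Definition generic (k0 k : fieldType) (n r : nat)
    (f : 'I_r -> freealg k n) : Prop :=
  exists H : nat -> nat,
    hilbert_series f H /\ hilbert_series (@generic_form k0 n r) H.

(* The image of iota, itself a subfield of k, lies in every subfield of k. *)
Definition is_prime_field (k0 k : fieldType) (iota : {rmorphism k0 -> k}) :
    Prop :=
  forall S : {pred k}, divring_closed S -> forall a, iota a \in S.

Definition alg_independent (k0 k : fieldType) (iota : {rmorphism k0 -> k})
    (N : nat) (t : 'I_N -> k) : Prop :=
  forall p : polyring k0 N, mpoly.mmap iota t p = 0 -> p = 0.

Definition trdeg_ge (k0 k : fieldType) (iota : {rmorphism k0 -> k})
    (N : nat) : Prop :=
  exists t : 'I_N -> k, alg_independent iota t.

(* The family {x_i f_j} (index inl) together with {f_j x_i} (index inr). *)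
Definition side_mults (K : fieldType) (n r : nat) (f : 'I_r -> freealg K n)
    (s : 'I_n * 'I_r + 'I_n * 'I_r) : freealg K n :=
  match s with
  | inl (i, j) => fvar K i * f j
  | inr (i, j) => f j * fvar K i
  end.

Definition lin_independent (K : fieldType) (V : lmodType K) (T : finType)
    (v : T -> V) : Prop :=
  forall a : T -> K, \sum_s a s *: v s = 0 -> forall s, a s = 0.

Definition spans_degree (K : fieldType) (n d : nat) (T : finType)
    (v : T -> freealg K n) : Prop :=
  (forall s, homogeneous d (v s)) /\
  (forall g, homogeneous d g -> exists a : T -> K, g = \sum_s a s *: v s).

(* Main.v *)
(* The coefficients of the 2nr elements x_i f_j, f_j x_i form a matrix M whose
   rank is n^3 - dim B_3, where B is the quotient algebra; so genericity says
   that M has the same rank for f as for the forms with indeterminate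
   coefficients, and that rank is at least the one obtained by specializing
   the indeterminates in k0. It is enough to exhibit, for all n and r,
   r quadratic forms over k0 for which M has full row or column rank.

   For n = 2m take generators x_p, y_p (p < m) and the n^2/2 forms
   x_p x_q - y_p y_q, x_p y_q, for which M is square and invertible. For
   n = 2m + 1 add a generator z and the 2m forms x_p z - z x_p - z y_p and
   y_p z - z y_p: the n^3 - n rows are then independent, and adjoining z z
   makes them span. Other values of r are reached by dropping or repeating
   forms. *)
Require Import Defs.
From HB Require Import structures.
From mathcomp Require Import all_boot all_algebra.
From mathcomp Require Import mpoly.
From mathcomp Require Import monalg.
From mathcomp Require Import ring zify.

Set Implicit Arguments.
Unset Strict Implicit.
Unset Printing Implicit Defensive.

Import GRing.Theory.
Local Open Scope ring_scope.

(** * Families of vectors as matrices: independence is full row rank, totality full column rank *)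

Section FamilyMatrix.
Variables (T W : finType).

Definition family_mx (R : Type) (v : T -> W -> R) : 'M[R]_(#|T|, #|W|) :=
  \matrix_(i, j) v (enum_val i) (enum_val j).

Definition indep_family (R : nzRingType) (v : T -> W -> R) : Prop :=
  forall a : T -> R, (forall w, \sum_t a t * v t w = 0) -> forall t, a t = 0.

(** Over a field this says dually that the rows span: no nonzero functional kills them all. In this
    form, spanning is proved by solving equations for one unknown [phi]. *)
Definition total_family (R : nzRingType) (v : T -> W -> R) : Prop :=
  forall phi : W -> R,
    (forall t, \sum_w v t w * phi w = 0) -> forall w, phi w = 0.

Lemma big_enum_val_type (V : nmodType) (U : finType) (F : U -> V) :
  \sum_u F u = \sum_(i < #|U|) F (enum_val i).
Proof. exact: reindex (onW_bij _ (@enum_val_bij U)). Qed.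

Lemma row_free_familyP (K : fieldType) (v : T -> W -> K) :
  indep_family v <-> row_free (family_mx v).
Proof.
split=> [indep_v | free_v a av0 t].
- apply: inj_row_free => u uv0; apply/rowP => i; rewrite mxE.
  rewrite -(enum_valK i) (indep_v (fun t => u 0 (enum_rank t))) // => w.
  have := congr1 (fun x : 'rV_#|W| => x 0 (enum_rank w)) uv0.
  rewrite !mxE; apply: etrans; rewrite big_enum_val_type; apply: eq_bigr => j _.
  by rewrite mxE enum_valK enum_rankK.
- have /eqP : (\row_i a (enum_val i)) *m family_mx v == 0.
    apply/eqP/rowP => j; rewrite !mxE; apply: etrans (av0 (enum_val j)).
    rewrite [RHS]big_enum_val_type.
    by apply: eq_bigr => i _; rewrite !mxE.
  move/eqP; rewrite mulmx_free_eq0 // => /eqP/rowP/(_ (enum_rank t)).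
  by rewrite !mxE enum_rankK.
Qed.

Lemma row_full_familyP (K : fieldType) (v : T -> W -> K) :
  total_family v <-> row_full (family_mx v).
Proof.
rewrite /row_full -mxrank_tr -/(row_free _).
split=> [tot_v | free_v phi phi0 w].
- apply: inj_row_free => u uv0; apply/rowP => i; rewrite mxE.
  rewrite -(enum_valK i) (tot_v (fun t => u 0 (enum_rank t))) // => t.
  have := congr1 (fun x : 'rV_#|T| => x 0 (enum_rank t)) uv0.
  rewrite !mxE; apply: etrans; rewrite big_enum_val_type; apply: eq_bigr => j _.
  by rewrite !mxE enum_valK enum_rankK mulrC.
- have /eqP : (\row_i phi (enum_val i)) *m (family_mx v)^T == 0.
    apply/eqP/rowP => j; rewrite !mxE; apply: etrans (phi0 (enum_val j)).
    rewrite [RHS]big_enum_val_type.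
    by apply: eq_bigr => i _; rewrite !mxE mulrC.
  move/eqP; rewrite mulmx_free_eq0 // => /eqP/rowP/(_ (enum_rank w)).
  by rewrite !mxE enum_rankK.
Qed.

(** The matrix is square, so full column rank forces full row rank. Independence of the explicit
    families below is deduced from totality in this way. *)
Lemma total_family_indep (K : fieldType) (v : T -> W -> K) :
  #|T| = #|W| -> total_family v -> indep_family v.
Proof.
by move=> eqTW /row_full_familyP /eqP fv; apply/row_free_familyP/eqP; rewrite fv.
Qed.

End FamilyMatrix.

(** * Dropping, repeating and renaming rows *)

Section Reindexing.
Variables (K : fieldType) (T T' W W' : finType) (v : T -> W -> K).
Variables (s : T' -> T) (h : W' -> W).

Lemma indep_family_reindex :
  injective s -> bijective h ->
  indep_family v -> indep_family (fun t w => v (s t) (h w)).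
Proof.
move=> inj_s [h' hK h'K] indep_v a a0 t'.
(* The relation is pushed forward along [s] by summing over fibres; injectivity makes the fibre over
   [s t'] a singleton. *)
rewrite -[RHS](indep_v (fun t => \sum_(t0 | s t0 == t) a t0) _ (s t')).
  rewrite (big_pred1 t') // => t0; exact: inj_eq.
move=> w; apply: etrans (a0 (h' w)); rewrite [RHS](partition_big s predT) //= h'K.
apply: eq_bigr => t _; rewrite mulr_suml.
by apply: eq_bigr => t0 /eqP->.
Qed.

Lemma total_family_reindex :
  (forall t, exists t', s t' = t) -> bijective h ->
  total_family v -> total_family (fun t w => v (s t) (h w)).
Proof.
move=> surj_s bij_h tot_v phi phi0 w'.
have [h' hK h'K] := bij_h.
rewrite -[w']hK; apply: (tot_v (phi \o h')) => t.
have [t' <-] := surj_s t; apply: etrans (phi0 t').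
rewrite (reindex h) /=; last exact: onW_bij.
by apply: eq_bigr => w _; rewrite hK.
Qed.

End Reindexing.

(** * The coefficient matrix of the products x_i f_j and f_j x_i *)

Section SideFamily.
Variables (X J : finType).

(* [C j (b, c)] is the coefficient of x_b x_c in the j-th quadratic form; the
   rows are those of the x_i f_j (index inl) and of the f_j x_i (index inr). *)
Definition side_family (R : nzRingType) (C : J -> X * X -> R)
    (s : X * J + X * J) (w : X * X * X) : R :=
  match s with
  | inl (i, j) => (w.1.1 == i)%:R * C j (w.1.2, w.2)
  | inr (i, j) => C j w.1 * (w.2 == i)%:R
  end.

Lemma sum_delta (R : nzRingType) (U : finType) (u : U) (F : U -> R) :
  \sum_x (x == u)%:R * F x = F u.
Proof.
rewrite (bigD1 u) //= eqxx mul1r big1 ?addr0 // => x /negPf->.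
by rewrite mul0r.
Qed.

(** This turns annihilation of all rows into local conditions: [phi] kills every form placed in the
    last two slots (rows [inl]) and in the first two slots (rows [inr]), whatever the remaining
    letter. *)
Lemma side_family_pairing (K : fieldType) (C : J -> X * X -> K)
    (phi : X * X * X -> K) :
  (forall i j, \sum_w side_family C (inl (i, j)) w * phi w =
     \sum_u C j u * phi (i, u.1, u.2)) *
  (forall i j, \sum_w side_family C (inr (i, j)) w * phi w =
     \sum_u C j u * phi (u, i)).
Proof.
split=> i j.
- rewrite (eq_bigr (fun w => (fun p c => (p.1 == i)%:R * C j (p.2, c) *
    phi (p, c)) w.1 w.2)); last by move=> [].
  rewrite -(pair_big predT predT (fun p c => (p.1 == i)%:R * C j (p.2, c) *
    phi (p, c))) /=.
  rewrite (eq_bigr (fun p => (fun a b => (a == i)%:R * \sum_c C j (b, c) *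
    phi (a, b, c)) p.1 p.2)); last first.
    by move=> [a b] _ /=; rewrite mulr_sumr; apply: eq_bigr => c _; rewrite mulrA.
  rewrite -(pair_big predT predT (fun a b => (a == i)%:R * \sum_c C j (b, c) *
    phi (a, b, c))) /=.
  under eq_bigr => a _ do rewrite -mulr_sumr.
  rewrite sum_delta pair_big /=.
  by apply: eq_bigr => -[b c].
- rewrite (eq_bigr (fun w => (fun p c => C j p * (c == i)%:R *
    phi (p, c)) w.1 w.2)); last by move=> [].
  rewrite -(pair_big predT predT (fun p c => C j p * (c == i)%:R *
    phi (p, c))) /=.
  apply: eq_bigr => p _.
  under eq_bigr => c _ do rewrite mulrAC mulrC.
  by rewrite sum_delta.
Qed.

Lemma map_side_family (R S : nzRingType) (g : {rmorphism R -> S})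
    (C : J -> X * X -> R) s w :
  g (side_family C s w) = side_family (fun j u => g (C j u)) s w.
Proof. by case: s => [] [i j] /=; rewrite rmorphM rmorph_nat. Qed.

End SideFamily.

(** * Renaming variables and changing the list of forms *)

Section SideReindexing.
Variables (K : fieldType) (X X' J J' : finType) (C : J -> X * X -> K).
Variables (h : X' -> X) (s : J' -> J).
Hypothesis bij_h : bijective h.

Let C' j (u : X' * X') := C (s j) (h u.1, h u.2).
Let hw (w : X' * X' * X') := (h w.1.1, h w.1.2, h w.2).
Let hs (t : X' * J' + X' * J') : X * J + X * J :=
  match t with inl p => inl (h p.1, s p.2) | inr p => inr (h p.1, s p.2) end.

Let side_familyE t w : side_family C' t w = side_family C (hs t) (hw w).
Proof.
by case: t => [] [i j]; case: w => [] [a b] c; rewrite /= (bij_eq bij_h).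
Qed.

Let bij_hw : bijective hw.
Proof.
have [h' hK h'K] := bij_h.
exists (fun w => (h' w.1.1, h' w.1.2, h' w.2)); move=> [[a b] c] /=.
  by rewrite !hK.
by rewrite /hw /= !h'K.
Qed.

Lemma indep_side_family_reindex :
  injective s -> indep_family (side_family C) -> indep_family (side_family C').
Proof.
move=> inj_s iC.
have inj_hs : injective hs.
  have inj_h := bij_inj bij_h.
  by move=> [[i j]|[i j]] [[i' j']|[i' j']] //= [/inj_h-> /inj_s->].
have := indep_family_reindex inj_hs bij_hw iC.
move=> iC' a a0; apply: iC' => w; rewrite -[RHS](a0 w).
by apply: eq_bigr => t _; rewrite side_familyE.
Qed.

Lemma total_side_family_reindex :
  (forall j, exists j', s j' = j) ->
  total_family (side_family C) -> total_family (side_family C').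
Proof.
move=> surj_s tC; have [h' hK h'K] := bij_h.
have surj_hs t : exists t', hs t' = t.
  case: t => [] [i j]; have [j' <-] := surj_s j.
    by exists (inl (h' i, j')); rewrite /= h'K.
  by exists (inr (h' i, j')); rewrite /= h'K.
have tC' := total_family_reindex surj_hs bij_hw tC.
move=> phi phi0; apply: tC' => t; rewrite -[RHS](phi0 t).
by apply: eq_bigr => w _; rewrite side_familyE.
Qed.

End SideReindexing.

(** * From two extreme systems of forms to every r *)

Section Interpolation.
Variables (K : fieldType) (n r : nat) (X J0 J1 : finType).
Variables (C0 : J0 -> X * X -> K) (C1 : J1 -> X * X -> K).

(** The bound on [#|J1|] leaves no gap: if r is at most [#|J0|], part of the independent system is
    kept; otherwise r is at least [#|J1|], and the total system is listed with repetitions. *)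
Lemma side_family_dichotomy (j1 : J1) :
  #|X| = n -> (#|J1| <= #|J0|.+1)%N ->
  indep_family (side_family C0) -> total_family (side_family C1) ->
  exists C : 'I_r -> 'I_n * 'I_n -> K,
    indep_family (side_family C) \/ total_family (side_family C).
Proof.
move=> cardX le_card i0 t1.
pose h (i : 'I_n) : X := enum_val (cast_ord (esym cardX) i).
have bij_h : bijective h.
  exists (fun x => cast_ord cardX (enum_rank x)) => x.
    by rewrite /h enum_valK cast_ordKV.
  by rewrite /h cast_ordK enum_rankK.
have [le_r | lt_r] := leqP r #|J0|.
- exists (fun j u => C0 (enum_val (widen_ord le_r j)) (h u.1, h u.2)); left.
  apply: (indep_side_family_reindex (s := fun j => enum_val (widen_ord le_r j)))
    => //.
  by move=> j j' /enum_val_inj/(congr1 val)/= /val_inj.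
(* Positions beyond the end of [enum J1] repeat the form [j1]. *)
- pose s (j : 'I_r) := nth j1 (enum J1) j.
  exists (fun j u => C1 (s j) (h u.1, h u.2)); right.
  apply: (total_side_family_reindex (s := s)) => // j.
  have lt_j : (enum_rank j < r)%N.
    exact: leq_trans (leq_trans (ltn_ord _) le_card) lt_r.
  exists (Ordinal lt_j); exact: nth_enum_rank.
Qed.

End Interpolation.

(** * The explicit forms in an even and in an odd number of variables *)

Section Forms.
Variables (K : fieldType) (m : nat).

Let E := (bool * 'I_m)%type.
Let x (p : 'I_m) : E := (true, p).
Let y (p : 'I_m) : E := (false, p).

Definition monomial_form (X : finType) (v u : X * X) : K := (u == v)%:R.

Lemma sum_monomial_form (X : finType) (v : X * X) (F : X * X -> K) :
  \sum_u monomial_form v u * F u = F v.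
Proof. exact: sum_delta. Qed.

Definition even_form (j : bool * ('I_m * 'I_m)) (u : E * E) : K :=
  let: (b, (p, q)) := j in
  if b then monomial_form (x p, x q) u - monomial_form (y p, y q) u
  else monomial_form (x p, y q) u.

(** Words containing xy in adjacent slots vanish. Replacing xx by yy in either position links yyy to
    xxy and xxx to xyy, so these vanish too; then yxx reduces to yyy and yyx to xxx. *)
Lemma even_functional (phi : E -> E -> E -> K) :
  (forall p q w, phi (x p) (x q) w = phi (y p) (y q) w) ->
  (forall p q w, phi (x p) (y q) w = 0) ->
  (forall p q w, phi w (x p) (x q) = phi w (y p) (y q)) ->
  (forall p q w, phi w (x p) (y q) = 0) ->
  forall a b c, phi a b c = 0.
Proof.
move=> lxx lxy rxx rxy.
have yyy a b c : phi (y a) (y b) (y c) = 0 by rewrite -lxx rxy.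
have xxx a b c : phi (x a) (x b) (x c) = 0 by rewrite rxx lxy.
move=> [[] a] [[] b] [[] c];
  rewrite -/(x a) -/(x b) -/(x c) -/(y a) -/(y b) -/(y c).
- exact: xxx.
- exact: rxy.
- exact: lxy.
- exact: lxy.
- by rewrite rxx yyy.
- exact: rxy.
- by rewrite -lxx xxx.
- exact: yyy.
Qed.

Lemma even_family_total : total_family (side_family even_form).
Proof.
move=> phi phi0.
have L i j := etrans (esym ((side_family_pairing even_form phi).1 i j)) (phi0 _).
have R i j := etrans (esym ((side_family_pairing even_form phi).2 i j)) (phi0 _).
move=> [[a b] c]; apply: (even_functional (phi := fun a b c => phi (a, b, c)));
  move=> p q w.
- apply/subr0_eq; rewrite -(R w (true, (p, q))) /=.
  under eq_bigr do rewrite mulrBl.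
  by rewrite sumrB !sum_monomial_form.
- by rewrite -(R w (false, (p, q))) /= sum_monomial_form.
- apply/subr0_eq; rewrite -(L w (true, (p, q))) /=.
  under eq_bigr do rewrite mulrBl.
  by rewrite sumrB !sum_monomial_form.
- by rewrite -(L w (false, (p, q))) /= sum_monomial_form.
Qed.

Lemma even_family_indep : indep_family (side_family even_form).
Proof.
apply: total_family_indep even_family_total.
(* There are 2m^2 forms in 2m variables, hence 2(2m)(2m^2) = (2m)^3 rows. *)
by rewrite card_sum !card_prod card_bool card_ord; ring.
Qed.

Let z : option E := None.
Let X (p : 'I_m) : option E := Some (x p).
Let Y (p : 'I_m) : option E := Some (y p).

(* [None] is z. The [inr] cases are the forms e z - z sigma(e), with
   sigma x = x + y and sigma y = y. They are chosen so that (sigma (x) sigma) R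
   is a complement of the span R of the even forms in degree 2. *)
Definition odd_form (j : bool * ('I_m * 'I_m) + bool * 'I_m)
    (u : option E * option E) : K :=
  match j with
  | inl (true, (p, q)) => monomial_form (X p, X q) u - monomial_form (Y p, Y q) u
  | inl (false, (p, q)) => monomial_form (X p, Y q) u
  | inr (true, p) =>
      monomial_form (X p, z) u - monomial_form (z, X p) u
      - monomial_form (z, Y p) u
  | inr (false, p) => monomial_form (Y p, z) u - monomial_form (z, Y p) u
  end.

Definition odd_form1 j : option E * option E -> K :=
  if j is Some j' then odd_form j' else monomial_form (z, z).

(** Words without z vanish by the even case. The forms with z allow z to be moved to the left, which
    reduces the other words to z e e' and to words beginning with zz; the latter vanish by
    hypothesis. *)
Lemma odd_functional (phi : option E * option E * option E -> K) :
  (forall t, \sum_w side_family odd_form t w * phi w = 0) ->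
  (forall w, phi (z, z, w) = 0) -> forall w, phi w = 0.
Proof.
move=> phi0 phizz.
have L i j := etrans (esym ((side_family_pairing odd_form phi).1 i j)) (phi0 _).
have R i j := etrans (esym ((side_family_pairing odd_form phi).2 i j)) (phi0 _).
have lxx p q w : phi (X p, X q, w) = phi (Y p, Y q, w).
  apply/subr0_eq; rewrite -(R w (inl (true, (p, q)))) /=.
  under eq_bigr do rewrite mulrBl.
  by rewrite sumrB !sum_monomial_form.
have rxx p q w : phi (w, X p, X q) = phi (w, Y p, Y q).
  apply/subr0_eq; rewrite -(L w (inl (true, (p, q)))) /=.
  under eq_bigr do rewrite mulrBl.
  by rewrite sumrB !sum_monomial_form.
have lxy p q w : phi (X p, Y q, w) = 0.
  by rewrite -(R w (inl (false, (p, q)))) /= sum_monomial_form.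
have rxy p q w : phi (w, X p, Y q) = 0.
  by rewrite -(L w (inl (false, (p, q)))) /= sum_monomial_form.
have lxz p w : phi (X p, z, w) = phi (z, X p, w) + phi (z, Y p, w).
  apply/subr0_eq; rewrite -(R w (inr (true, p))) /=.
  under eq_bigr do rewrite !mulrBl.
  by rewrite !sumrB !sum_monomial_form opprD addrA.
have rxz p w : phi (w, X p, z) = phi (w, z, X p) + phi (w, z, Y p).
  apply/subr0_eq; rewrite -(L w (inr (true, p))) /=.
  under eq_bigr do rewrite !mulrBl.
  by rewrite !sumrB !sum_monomial_form opprD addrA.
have lyz p w : phi (Y p, z, w) = phi (z, Y p, w).
  apply/subr0_eq; rewrite -(R w (inr (false, p))) /=.
  under eq_bigr do rewrite !mulrBl.
  by rewrite !sumrB !sum_monomial_form.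
have ryz p w : phi (w, Y p, z) = phi (w, z, Y p).
  apply/subr0_eq; rewrite -(L w (inr (false, p))) /=.
  under eq_bigr do rewrite !mulrBl.
  by rewrite !sumrB !sum_monomial_form.
have eee a b c : phi (Some a, Some b, Some c) = 0.
  pose psi a b c := phi (Some a, Some b, Some c).
  by apply: (even_functional (phi := psi)) => *; rewrite /psi;
    [exact: lxx | exact: lxy | exact: rxx | exact: rxy].
(* The words z e e' satisfy the even relations R directly. Moving z from right to left in the
   relations on words e e' z gives also the relations (sigma (x) sigma) R, and together these force
   vanishing. *)
have zxy p q : phi (z, X p, Y q) = 0 by [].
have zyy p q : phi (z, Y p, Y q) = 0.
  by have := lxy p q z; rewrite ryz lxz zxy add0r.
have zxx p q : phi (z, X p, X q) = 0 by rewrite rxx.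
have zyx p q : phi (z, Y p, X q) = 0.
  have := lxx p q z.
  by rewrite rxz ryz !lxz lyz zxx zxy zyy add0r !addr0.
have zee a b : phi (z, Some a, Some b) = 0.
  case: a b => [[] p] [[] q]; [exact: zxx|exact: zxy|exact: zyx|exact: zyy].
(* From here on, each kind of word is rewritten with z one place further left, where vanishing is
   already known. *)
have eze a b : phi (Some a, z, Some b) = 0.
  by case: a => [[] p]; rewrite -/(X p) -/(Y p) ?lxz ?lyz !zee ?addr0.
have eez a b : phi (Some a, Some b, z) = 0.
  by case: b => [[] p]; rewrite -/(X p) -/(Y p) ?rxz ?ryz !eze ?addr0.
have zez a : phi (z, Some a, z) = 0.
  by case: a => [[] p]; rewrite -/(X p) -/(Y p) ?rxz ?ryz !phizz ?addr0.
have ezz a : phi (Some a, z, z) = 0.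
  by case: a => [[] p]; rewrite -/(X p) -/(Y p) ?lxz ?lyz !zez ?addr0.
by move=> [[[a|] [b|]] [c|]] //; apply: phizz.
Qed.

(** The rows are completed by the n unit vectors at the words zzc. The enlarged family is total and
    square, hence independent, and so is its subfamily. *)
Lemma odd_family_indep : indep_family (side_family odd_form).
Proof.
pose v t w := match t with
  | inl s => side_family odd_form s w
  | inr c => (w == (z, z, c))%:R
  end.
have tot_v : total_family v.
  move=> phi phi0; apply: odd_functional => [t | c]; first exact: (phi0 (inl t)).
  by rewrite -(phi0 (inr c)) /= sum_delta.
pose J := (bool * ('I_m * 'I_m) + bool * 'I_m)%type.
have card_v : #|{: (option E * J + option E * J) + option E}| =
    #|{: option E * option E * option E}|.
  (* With n = 2m + 1 there are 2m^2 + 2m = (n^2 - 1)/2 forms, so n^3 - n rows before the n unit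
     vectors are added. *)
  rewrite !(card_sum, card_prod, card_option, card_bool, card_ord); ring.
have := indep_family_reindex inl_inj _ (total_family_indep card_v tot_v).
by apply; exists id.
Qed.

Lemma odd_family_total : total_family (side_family odd_form1).
Proof.
move=> phi phi0; apply: odd_functional => [t | c].
  case: t => [] [i j]; first exact: (phi0 (inl (i, Some j))).
  (* The remaining condition, on words zzc, comes from the rows (zz)c of the extra form. *)
  exact: (phi0 (inr (i, Some j))).
rewrite -(phi0 (inr (c, None))) (side_family_pairing odd_form1 phi).2.
by rewrite sum_monomial_form.
Qed.

End Forms.

Lemma exists_good_forms (K : fieldType) (n r : nat) : (0 < n)%N ->
  exists C : 'I_r -> 'I_n * 'I_n -> K,
    indep_family (side_family C) \/ total_family (side_family C).
Proof.
move=> n_gt0; have := odd_double_half n; case: (odd n) => /= def_n.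
- apply: (side_family_dichotomy r None _ _ (@odd_family_indep K n./2)
    (@odd_family_total K n./2)).
    by rewrite card_option card_prod card_bool card_ord mul2n.
  by rewrite card_option.
(* For even n the same system serves at both ends; positivity of n supplies a form to repeat. *)
- have m_gt0 : (0 < n./2)%N by rewrite -double_gt0 -[_.*2]add0n def_n.
  pose p := Ordinal m_gt0.
  apply: (side_family_dichotomy r (true, (p, p)) _ _ (@even_family_indep K n./2)
    (@even_family_total K n./2)) => //.
  by rewrite card_prod card_bool card_ord mul2n.
Qed.

(** * Full rank after specialization implies full rank over the fraction field *)

Section Specialization.
Variables (K : fieldType) (P : idomainType) (g : {rmorphism P -> K}).
Variables (c : {rmorphism K -> P}).
Hypothesis gcK : cancel c g.

(** A right inverse B of the specialized matrix lifts through [c]. The determinant of A times the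
    lift specializes to 1, so it is nonzero and the product is invertible over the fraction
    field. *)
Lemma row_free_specialization p q (A : 'M[P]_(p, q)) :
  row_free (map_mx g A) -> row_free (map_mx (@tofrac P) A).
Proof.
case/row_freeP => B gAB.
have detAB : \det (A *m map_mx c B) != 0.
  apply: contraTneq (oner_neq0 K) => det0; rewrite negbK.
  have gcB : map_mx g (map_mx c B) = B.
    by apply/matrixP => i j; rewrite !mxE gcK.
  by rewrite -(det1 K p) -gAB -{1}gcB -map_mxM det_map_mx det0 rmorph0.
have uAB : map_mx (@tofrac P) A *m map_mx (@tofrac P) (map_mx c B) \in unitmx.
  by rewrite -map_mxM unitmxE det_map_mx unitfE tofrac_eq0.
apply/row_freeP; exists (map_mx (@tofrac P) (map_mx c B) *m
  invmx (map_mx (@tofrac P) A *m map_mx (@tofrac P) (map_mx c B))).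
by rewrite mulmxA mulmxV.
Qed.

Lemma row_full_specialization p q (A : 'M[P]_(p, q)) :
  row_full (map_mx g A) -> row_full (map_mx (@tofrac P) A).
Proof.
rewrite /row_full -mxrank_tr -(mxrank_tr (map_mx (@tofrac P) A)) !map_trmx.
exact: row_free_specialization.
Qed.

End Specialization.

(** * Coefficients and degree 3 coordinates in the free algebra *)

Section FreeAlgebra.
Variables (K : fieldType) (n : nat).
Implicit Types (g h : freealg K n) (m : {fmonom 'I_n}).

Lemma homogeneousM d e g h :
  homogeneous d g -> homogeneous e h -> homogeneous (d + e)%N (g * h).
Proof.
move=> hom_g hom_h m; rewrite mcoeff_neq0 => /msuppM_le[m1 [m2 [m1g m2h ->]]].
by rewrite fdegM hom_g ?hom_h ?mcoeff_neq0.
Qed.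

Lemma homogeneousU m : homogeneous (fdeg m) (<< m >> : freealg K n).
Proof.
by move=> m'; rewrite mcoeffU1; case: (m =P m') => [->|_] //; rewrite eqxx.
Qed.

Lemma homogeneous_var i : homogeneous 1 (fvar K i : freealg K n).
Proof. by rewrite -(fdegU i); apply: homogeneousU. Qed.

Lemma homogeneous_lincomb d (T : finType) (a : T -> K) (v : T -> freealg K n) :
  (forall t, homogeneous d (v t)) -> homogeneous d (\sum_t a t *: v t).
Proof.
move=> hom_v m; rewrite raddf_sum /=; apply: contraNeq => deg_m.
rewrite big1 // => t _; rewrite mcoeffZ.
suff -> : mcoeff m (v t) = 0 by rewrite mulr0.
by apply: contraNeq deg_m => /hom_v->.
Qed.

Lemma mcoeff_varM i a m g :
  mcoeff (mmul (fmu a) m) (fvar K i * g) = (a == i)%:R * mcoeff m g.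
Proof.
rewrite malgM_def fgmulUg raddf_sum /=.
rewrite [in RHS](monalgE g) raddf_sum mulr_sumr /=; apply: eq_bigr => k _.
rewrite !mcoeffU mul1r mulrnAr mulr_natl -mulrnA; congr (_ *+ _).
by rewrite -val_eqE /= !fmM !fmU /= eqseq_cons [i == a]eq_sym mulnb andbC.
Qed.

Lemma mcoeff_Mvar i a m g :
  mcoeff (mmul m (fmu a)) (g * fvar K i) = mcoeff m g * (a == i)%:R.
Proof.
rewrite malgM_def fgmulgU raddf_sum /=.
rewrite [in RHS](monalgE g) raddf_sum mulr_suml /=; apply: eq_bigr => k _.
rewrite !mcoeffU mulr1 mulr_natr -mulrnA; congr (_ *+ _).
rewrite -val_eqE /= !fmM !fmU /= !cats1 eqseq_rcons [i == a]eq_sym mulnb.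
by rewrite val_eqE.
Qed.

Lemma mcoeffZU a m l :
  mcoeff l (a *: << m >> : freealg K n) = (m == l)%:R * a.
Proof.
by apply: etrans (mcoeffZ _ _ _) _; rewrite (mcoeffU m 1) mulr_natr mulr_natl.
Qed.

Lemma malgUE a m : << a *g m >> = a *: << m >> :> freealg K n.
Proof.
apply/malgP => l; apply: etrans (mcoeffU _ _ _) _.
by rewrite mcoeffZU mulr_natl.
Qed.

Lemma malg_monomE g :
  g = \sum_(m <- finmap.enum_fset (msupp g)) mcoeff m g *: << m >>.
Proof.
apply: etrans (monalgE g) _; apply: eq_bigr => m _; exact: malgUE.
Qed.

(** Scalars are central: [K] is commutative and the empty word commutes with every word. *)
Lemma malg_scalerAr (a : K) g h : g * (a *: h) = a *: (g * h).
Proof.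
have comm : g * malgC a = malgC a * g.
  apply: etrans (fgmulgU _ _ _) (etrans _ (esym (fgmulUg _ _ _))).
  by apply: eq_bigr => k _; rewrite mulrC mulm1 mul1m.
apply: etrans (congr1 (fun u => g * u) (esym (mul_malgC a h))) _.
by apply: etrans (mulrA _ _ _) _; rewrite comm -mulrA; apply: mul_malgC.
Qed.

Definition word3 (w : 'I_n * 'I_n * 'I_n) : {fmonom 'I_n} :=
  mmul (mmul (fmu w.1.1) (fmu w.1.2)) (fmu w.2).

Definition coef3 g : 'rV[K]_#|{: 'I_n * 'I_n * 'I_n}| :=
  \row_j mcoeff (word3 (enum_val j)) g.

Lemma fdeg_word3 w : fdeg (word3 w) = 3%N.
Proof. by rewrite !fdegM !fdegU. Qed.

Lemma word3P m : fdeg m = 3%N -> exists w, m = word3 w.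
Proof.
case: m => [[|a [|b [|c []]]]] // _; exists (a, b, c).
by apply: val_inj; rewrite /= !fmM !fmU.
Qed.

Lemma word3_inj : injective word3.
Proof.
move=> [[a b] c] [[a' b'] c'] /(congr1 val) /=.
by rewrite !fmM !fmU /= => -[-> -> ->].
Qed.

Fact coef3_is_linear : linear coef3.
Proof. by move=> a g h; apply/rowP => j; rewrite !mxE mcoeffD mcoeffZ. Qed.
HB.instance Definition _ :=
  GRing.isLinear.Build K (freealg K n) 'rV[K]_#|{: 'I_n * 'I_n * 'I_n}| _ coef3
    coef3_is_linear.

Lemma coef3_inj g h : homogeneous 3 g -> homogeneous 3 h ->
  coef3 g = coef3 h -> g = h.
Proof.
move=> hom_g hom_h eq_gh; apply/malgP => m.
have [/word3P[w ->] | deg_m] := eqVneq (fdeg m) 3%N.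
  by have /rowP/(_ (enum_rank w)) := eq_gh; rewrite !mxE enum_rankK.
have z u : homogeneous 3 u -> mcoeff m u = 0.
  by move=> hom_u; apply: contraNeq deg_m => /hom_u->.
by rewrite !z.
Qed.

Lemma coef3_surj v : exists2 g, homogeneous 3 g & coef3 g = v.
Proof.
exists (\sum_w v 0 (enum_rank w) *: << word3 w >>).
  by apply: homogeneous_lincomb => w; rewrite -(fdeg_word3 w); apply: homogeneousU.
apply/rowP => j; rewrite mxE raddf_sum /=.
under eq_bigr => w _ do rewrite mcoeffZU (inj_eq word3_inj).
by rewrite sum_delta enum_valK.
Qed.

(** * The degree 3 part of the ideal and the rank of the coefficient matrix *)

Section QuadraticForms.
Variables (r : nat) (f : 'I_r -> freealg K n).
Hypothesis hquad : forall j, homogeneous 2 (f j).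

Definition quad_coef (j : 'I_r) (u : 'I_n * 'I_n) : K :=
  mcoeff (mmul (fmu u.1) (fmu u.2)) (f j).

Local Notation M := (family_mx (side_family quad_coef)).

Lemma mcoeff_side_mults s w :
  mcoeff (word3 w) (side_mults f s) = side_family quad_coef s w.
Proof.
case: s => [] [i j] /=; last exact: mcoeff_Mvar.
by rewrite /word3 -mulmA mcoeff_varM.
Qed.

Lemma homogeneous_side_mults s : homogeneous 3 (side_mults f s).
Proof.
case: s => [] [i j].
  apply: (homogeneousM (@homogeneous_var i) (@hquad j)).
apply: (homogeneousM (@hquad j) (@homogeneous_var i)).
Qed.

Lemma coef3_side_mults s : coef3 (side_mults f s) = row (enum_rank s) M.
Proof. by apply/rowP => j; rewrite !mxE enum_rankK mcoeff_side_mults. Qed.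

Lemma coef3_side_comb (a : 'I_n * 'I_r + 'I_n * 'I_r -> K) :
  coef3 (\sum_s a s *: side_mults f s) = (\row_i a (enum_val i)) *m M.
Proof.
rewrite linear_sum mulmx_sum_row big_enum_val_type /=.
by apply: eq_bigr => i _; rewrite linearZ /= coef3_side_mults enum_valK mxE.
Qed.

Lemma row_free_lin_independent : row_free M -> lin_independent (side_mults f).
Proof.
move=> free_M a a0 s; apply: (proj2 (row_free_familyP _) free_M a) => w.
have := congr1 (mcoeff (word3 w)) a0; rewrite raddf_sum mcoeff0 /=.
by apply: etrans; apply: eq_bigr => t _; rewrite mcoeffZ mcoeff_side_mults.
Qed.

Lemma submx_side_comb g : homogeneous 3 g -> (coef3 g <= M)%MS ->
  exists a, g = \sum_s a s *: side_mults f s.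
Proof.
move=> hom_g /submxP[D gD]; exists (fun s => D 0 (enum_rank s)).
apply: coef3_inj => //.
  by apply: homogeneous_lincomb => s; apply: homogeneous_side_mults.
rewrite coef3_side_comb gD; congr (_ *m _).
by apply/rowP => i; rewrite mxE enum_valK.
Qed.

Lemma row_full_spans : row_full M -> spans_degree 3 (side_mults f).
Proof.
move=> full_M; split=> [s | g hom_g]; first exact: homogeneous_side_mults.
by apply: submx_side_comb => //; apply: submx_full.
Qed.

Lemma ideal_side_comb a : ideal_of f (\sum_s a s *: side_mults f s).
Proof.
exists [seq match s with
        | inl (i, j) => (a s *: fvar K i, j, 1)
        | inr (i, j) => (a s *: 1, j, fvar K i)
        end | s <- index_enum _].
rewrite big_map; apply: eq_bigr => -[] [i j] _ /=.
  by rewrite mulr1 scalerAl.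
by rewrite -!scalerAl mul1r.
Qed.

(** The product is homogeneous of degree deg m + 2 + deg m'. Unless this is 3 its degree 3
    coordinates vanish; if it is 3, one of the two words is empty and the other is a single
    letter. *)
Lemma coef3_monomial_mults m m' j : (coef3 (<< m >> * f j * << m' >>) <= M)%MS.
Proof.
have hom := homogeneousM (homogeneousM (@homogeneousU m) (@hquad j))
  (@homogeneousU m').
have [deg | deg] := eqVneq (fdeg m + 2 + fdeg m')%N 3; last first.
  suff -> : coef3 (<< m >> * f j * << m' >>) = 0 by apply: sub0mx.
  apply/rowP => i; rewrite !mxE; apply: contraNeq deg => /hom <-.
  by rewrite fdeg_word3.
case: (posnP (fdeg m)) deg => [/fdeg_eq0I-> | m_gt0] deg.
  have [i ->] : exists i, m' = fmu i.
    have : size m' = 1%N by move: deg; rewrite fdeg1 => -[].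
    case: m' {hom deg} => [[|i []]] // _; exists i.
    by apply: val_inj; rewrite /= fmU.
  have -> : << mone >> * f j * << fmu i >> = side_mults f (inr (i, j)).
    by rewrite [X in X * f j](_ : _ = 1) ?mul1r.
  by rewrite coef3_side_mults row_sub.
have /fdeg_eq0I-> : fdeg m' = 0%N by lia.
have [i ->] : exists i, m = fmu i.
  have : size m = 1%N by rewrite -fdegE; lia.
  case: m {hom deg m_gt0} => [[|i []]] // _; exists i.
  by apply: val_inj; rewrite /= fmU.
have -> : << fmu i >> * f j * << mone >> = side_mults f (inl (i, j)).
  by rewrite [X in _ * X](_ : _ = 1) ?mulr1.
by rewrite coef3_side_mults row_sub.
Qed.

Lemma coef3_ideal g : ideal_of f g -> (coef3 g <= M)%MS.
Proof.
case=> s ->; rewrite linear_sum; apply: summx_sub => -[[g1 j] g2] _ /=.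
rewrite (malg_monomE g1) [_ * f j]mulr_suml mulr_suml linear_sum /=.
apply: summx_sub => m _.
rewrite (malg_monomE g2) mulr_sumr linear_sum /=; apply: summx_sub => m' _.
rewrite malg_scalerAr -!scalerAl linearZ /= linearZ /=.
by rewrite !scalemx_sub // coef3_monomial_mults.
Qed.

(** The row space of [M] is the degree 3 part of the ideal, in coordinates. Representatives of a
    basis of the quotient span a complement of it: independence gives trivial intersection,
    generation gives the full sum. *)
Lemma quotient_dim_rank d : quotient_dim f 3 d ->
  (d + \rank M)%N = #|{: 'I_n * 'I_n * 'I_n}|.
Proof.
case=> b [hom_b free_b span_b].
pose B := \matrix_(i < d) coef3 (b i).
have coef3_comb (u : 'rV_d) : coef3 (\sum_i u 0 i *: b i) = u *m B.
  rewrite linear_sum mulmx_sum_row /=.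
  by apply: eq_bigr => i _; rewrite linearZ /= rowK.
have B_sub_M (u : 'rV_d) : (u *m B <= M)%MS -> u = 0.
  rewrite -coef3_comb => /submx_side_comb[|a def_b].
    exact: homogeneous_lincomb.
  apply/rowP => i; rewrite mxE; apply: (free_b (fun i => u 0 i)).
  by rewrite def_b; apply: ideal_side_comb.
have free_B : \rank B = d.
  by apply/eqP/inj_row_free => u uB0; apply: B_sub_M; rewrite uB0 sub0mx.
have capBM : (B :&: M)%MS = 0.
  apply/eqP/rowV0P => v; rewrite sub_capmx => /andP[/submxP[u ->] /B_sub_M->].
  exact: mul0mx.
have sumBM : row_full (B + M)%MS.
  rewrite -sub1mx; apply/row_subP => i; set v := row i _.
  have [g hom_g <-] := coef3_surj v; have [a /coef3_ideal] := span_b g hom_g.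
  rewrite linearB /= => gM; rewrite -[coef3 g](subrK (coef3 (\sum_i a i *: b i))).
  rewrite addmx_sub //; first exact: submx_trans gM (addsmxSr _ _).
  have -> : \sum_i a i *: b i = \sum_i (\row_j a j) 0 i *: b i.
    by apply: eq_bigr => j _; rewrite mxE.
  by rewrite coef3_comb (submx_trans (submxMl _ _)) ?addsmxSl.
by rewrite -{1}free_B -(mxrank_disjoint_sum capBM); apply/eqP.
Qed.

End QuadraticForms.
End FreeAlgebra.

(** * The forms with indeterminate coefficients *)

Section GenericForms.
Variables (k0 : fieldType) (n r : nat).

Lemma mcoeff_fvar2 (K : fieldType) (u v : 'I_n * 'I_n) :
  mcoeff (mmul (fmu u.1) (fmu u.2)) (fvar K v.1 * fvar K v.2) = (u == v)%:R.
Proof.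
rewrite mcoeff_varM -[fmu u.2](mul1m) -[fvar K v.2]mul1r mcoeff_Mvar.
rewrite mcoeff1 eqxx mul1r -natrM mulnb.
by case: u v => [u1 u2] [v1 v2]; rewrite xpair_eqE.
Qed.

Lemma quad_coef_generic_form j u :
  quad_coef (@generic_form k0 n r) j u = indet k0 (j, u).
Proof.
rewrite /quad_coef /generic_form raddf_sum /=.
rewrite -[RHS](sum_delta u (fun v => indet k0 (j, v))); apply: eq_bigr => v _.
by apply: etrans (mcoeffZ _ _ _) _; rewrite mcoeff_fvar2 eq_sym mulrC.
Qed.

Lemma homogeneous_generic_form j : homogeneous 2 (@generic_form k0 n r j).
Proof.
apply: homogeneous_lincomb => u.
by apply: (@homogeneousM _ _ 1 1); apply: homogeneous_var.
Qed.

Local Notation P := (polyring k0 #|{: coef_index n r}|).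

(** The coefficients are kept in the polynomial ring, where evaluation is defined everywhere, before
    passing to fractions. *)
Definition generic_coef (j : 'I_r) (u : 'I_n * 'I_n) : P :=
  mpoly.mpolyX k0 (mpoly.mnm1 (enum_rank (j, u))).

Lemma generic_family_mx :
  family_mx (side_family (quad_coef (@generic_form k0 n r))) =
  map_mx (@tofrac P) (family_mx (side_family generic_coef)).
Proof.
apply/matrixP => i j; rewrite !mxE map_side_family.
by case: (enum_val i) => [] [a b] /=; rewrite quad_coef_generic_form.
Qed.

Lemma generic_form_dichotomy : (0 < n)%N ->
  let M := family_mx (side_family (quad_coef (@generic_form k0 n r))) in
  row_free M \/ row_full M.
Proof.
move=> n_gt0 /=; have [C good_C] := exists_good_forms k0 r n_gt0.
(* Evaluation at the coefficients of the good forms; the constant polynomials provide its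
   section. *)
pose ev : {rmorphism P -> k0} :=
  mpoly.meval (fun t => let: (j, u) := enum_val t in C j u).
have evM : map_mx ev (family_mx (side_family generic_coef)) =
    family_mx (side_family C).
  apply/matrixP => i j; rewrite !mxE map_side_family.
  by case: (enum_val i) => [] [a b] /=; rewrite mpoly.mevalXU enum_rankK.
have evK : cancel (@mpoly.mpolyC #|{: coef_index n r}| k0) ev.
  by move=> a; apply: mpoly.mevalC.
rewrite generic_family_mx; case: good_C => [/row_free_familyP|/row_full_familyP].
  by rewrite -evM => /(row_free_specialization evK); left.
by rewrite -evM => /(row_full_specialization evK); right.
Qed.

End GenericForms.

Theorem theorem3p8 (k0 k : fieldType) (iota : {rmorphism k0 -> k})
    (hprime : is_prime_field iota)
    (n r : nat) (hn : (1 <= n)%N)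
    (htrdeg : trdeg_ge iota (r * n ^ 2))
    (f : 'I_r -> freealg k n)
    (hquad : forall j, homogeneous 2 (f j))
    (hgen : generic k0 f) :
  lin_independent (side_mults f) \/ spans_degree 3 (side_mults f).
Proof.
have [H [/(_ 3) Hf /(_ 3) Hgen]] := hgen.
have rk_f := quotient_dim_rank hquad Hf.
have rk_gen := quotient_dim_rank (@homogeneous_generic_form k0 n r) Hgen.
(* Both ranks equal n^3 - [H 3], and full row or column rank depends only on the rank, so it passes
   from the indeterminate forms to [f]. *)
have eq_rk := addnI (etrans rk_gen (esym rk_f)).
have [] := generic_form_dichotomy k0 r hn.
  by rewrite /row_free eq_rk => /(row_free_lin_independent (f := f)); left.
by rewrite /row_full eq_rk => /(row_full_spans hquad); right.
Qed.
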